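(* Let $G:\mathbb{R}_+\to\mathbb{R}_+$ be a nonincreasing kernel with $G(0)>0$ that preserves nonnegativity. Let $K\in\mathbb{N}^*$, $0\le t_1<\dots<t_K$ and $x_0,x_1,\dots,x_K\in\mathbb{R}$ be such that $x_0\ge 0$ and $$\forall k\in\{1,\dots,K\},\quad x_0+\sum_{k'=1}^k x_{k'}G(t_k-t_{k'})\ge 0.$$ Then $x_0+\sum_{k:\,t_k\le t}x_kG(t-t_k)\ge 0$ for all $t\ge 0$, where the sum runs over those $k\in\{1,\dots,K\}$ with $t_k\le t$.
   Context: Notation: $\mathbb{R}_+=[0,\infty)$, $\mathbb{N}^*=\{1,2,\dots\}$. Nonnegativity preserving kernel: a function (kernel) $G:\mathbb{R}_+\to\mathbb{R}_+$ with $G(0)>0$ is said to preserve nonnegativity if, for any $K\in\mathbb{N}^*$, any $x_1,\dots,x_K\in\mathbb{R}$ and any $0\le t_1<\dots<t_K$ such that $\sum_{k'=1}^k x_{k'}G(t_k-t_{k'})\ge 0$ for all $k\in\{1,\dots,K\}$, one has $\sum_{k:\,t_k\le t}x_kG(t-t_k)\ge 0$ for all $t\ge 0$ (an empty sum is $0$). *)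

(* Defs.v *)
From HB Require Import structures.
From mathcomp Require Import all_boot all_order all_algebra.
From mathcomp Require Import reals.

Set Implicit Arguments.
Unset Strict Implicit.
Unset Printing Implicit Defensive.

Import Order.TTheory GRing.Theory Num.Theory.
Local Open Scope ring_scope.

(* A kernel on [0, +oo) is a total function G : R -> R of which only the
   restriction to [0, +oo) matters: every argument of G below is nonnegative. *)
Definition nonneg_kernel (R : realType) (G : R -> R) : Prop :=
  (forall s : R, 0 <= s -> 0 <= G s) /\ 0 < G 0.

Definition nonincreasing_kernel (R : realType) (G : R -> R) : Prop :=
  forall s u : R, 0 <= s -> s <= u -> G u <= G s.

(* 0 <= t_1 < ... < t_K, where t_k is (t i) with i = k - 1 in 'I_K. *)
Definition time_grid (R : realType) (K : nat) (t : 'I_K -> R) : Prop :=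
  (forall i : 'I_K, 0 <= t i) /\ (forall i j : 'I_K, (i < j)%N -> t i < t j).

Definition preserves_nonnegativity (R : realType) (G : R -> R) : Prop :=
  forall (K : nat) (x t : 'I_K -> R),
    (0 < K)%N -> time_grid t ->
    (forall k : 'I_K, 0 <= \sum_(i < K | (i <= k)%N) x i * G (t k - t i)) ->
    forall s : R, 0 <= s -> 0 <= \sum_(i < K | t i <= s) x i * G (s - t i).

(* Main.v *)
Require Import Defs.
From mathcomp Require Import all_boot all_order all_algebra.
From mathcomp Require Import reals.

Import Order.TTheory GRing.Theory Num.Theory.
Local Open Scope ring_scope.

(** Choose weights [y_1, ..., y_K] with
    [\sum_(i <= k) y_i G (t_k - t_i) = x0] for all [k].  The system is
    triangular with diagonal [G 0 > 0], and the weights are nonnegative because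
    [G] is nonincreasing.  For the same reason
    [\sum_(t_i <= s) y_i G (s - t_i) <= x0] at every time [s].  Nonnegativity
    preservation applied to the weights [x_i + y_i] then concludes. *)

Lemma time_grid_le {R : realType} {K : nat} {t : 'I_K -> R} {i j : 'I_K} :
  time_grid t -> (i <= j)%N -> t i <= t j.
Proof.
move=> [_ t_incr]; rewrite leq_eqVlt => /orP[/eqP /val_inj -> //|].
by move=> /t_incr /ltW.
Qed.

(** A nonempty [P] is the initial segment ending at its largest index [m], so the equation at [m]
    sums over the same indices. Since [t m <= u], moving from [t m] to [u] can only lower each value
    of [G]. [P] is kept abstract to cover both [i < n] and [t i <= s]. *)
Lemma initial_conv_le {R : realType} {G : R -> R} {K : nat} {t y : 'I_K -> R}
    {c u : R} {P : pred 'I_K} :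
  nonincreasing_kernel G -> time_grid t -> 0 <= c -> (forall i, 0 <= y i) ->
  (forall i j : 'I_K, P j -> (i <= j)%N -> P i) ->
  (forall i, P i -> t i <= u) ->
  (forall k : 'I_K, P k -> \sum_(i < K | (i <= k)%N) y i * G (t k - t i) = c) ->
  \sum_(i < K | P i) y i * G (u - t i) <= c.
Proof.
move=> G_dec t_grid c_ge0 y_ge0 P_down P_le conv_eq.
case: (pickP P) => [i0 Pi0|P0]; last by rewrite big_pred0.
case: (arg_maxnP (fun i : 'I_K => i : nat) Pi0) => m Pm m_max.
have PE : P =1 (fun i => (i <= m)%N).
  by move=> i; apply/idP/idP => [/m_max|/(P_down _ _ Pm)].
rewrite -(conv_eq m Pm) (eq_bigl _ _ PE); apply: ler_sum => i le_im.
apply: ler_wpM2l => //; apply: G_dec.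
  by rewrite subr_ge0 time_grid_le.
by rewrite lerD2r P_le.
Qed.

Lemma constant_on_grid_weights {R : realType} {G : R -> R} {K : nat}
    {t : 'I_K -> R} {c : R} :
  0 < G 0 -> nonincreasing_kernel G -> time_grid t -> 0 <= c ->
  exists y : 'I_K -> R, (forall i, 0 <= y i) /\
    (forall k : 'I_K, \sum_(i < K | (i <= k)%N) y i * G (t k - t i) = c).
Proof.
move=> G0_gt0 G_dec t_grid c_ge0.
(* Forward substitution: the first [n] equations involve only weights of index below [n]; the later
   weights are arbitrary nonnegative values. *)
suff /(_ K)[y [y_ge0 y_eq]] : forall n, exists y : 'I_K -> R,
    (forall i, 0 <= y i) /\ (forall k : 'I_K, (k < n)%N ->
      \sum_(i < K | (i <= k)%N) y i * G (t k - t i) = c).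
  by exists y; split=> // k; apply: y_eq.
elim=> [|n [y [y_ge0 y_eq]]]; first by exists (fun=> 0).
have [lt_nK|le_Kn] := ltnP n K; last first.
  by exists y; split=> // k _; apply: y_eq; apply: leq_trans le_Kn.
pose k0 := Ordinal lt_nK.
pose S := \sum_(i < K | (i < n)%N) y i * G (t k0 - t i).
(* The new weight solves the equation at [k0], where its coefficient is [G 0]; it is nonnegative
   once [S <= c]. *)
pose z i := if i == k0 then (c - S) / G 0 else y i.
have S_le : S <= c.
  apply: initial_conv_le => //.
  - by move=> i j lt_jn le_ij; apply: leq_ltn_trans lt_jn.
  - by move=> i lt_in; apply: time_grid_le => //; apply: ltnW.
have zE (i : 'I_K) : (i < n)%N -> z i = y i.
  by move=> lt_in; rewrite /z -val_eqE /= ltn_eqF.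
exists z; split=> [i|k].
  rewrite /z; case: eqP => // _.
  by rewrite divr_ge0 ?subr_ge0 // ltW.
rewrite ltnS leq_eqVlt => /orP[/eqP kn|lt_kn]; last first.
  rewrite -[RHS](y_eq k lt_kn); apply: eq_bigr => i le_ik.
  by rewrite zE // (leq_ltn_trans le_ik).
have {k kn}-> : k = k0 by apply: val_inj.
rewrite (bigD1 k0) //= subrr /z eqxx divfK ?gt_eqF //.
rewrite (eq_bigl (fun i : 'I_K => (i < n)%N)); last first.
  by move=> i; rewrite ltn_neqAle andbC -val_eqE.
rewrite (eq_bigr (fun i => y i * G (t k0 - t i))) ?subrK // => i lt_in.
by rewrite -/(z i) zE.
Qed.

Theorem proposition2p8 (R : realType) (G : R -> R)
    (G_kernel : nonneg_kernel G)
    (G_nonincreasing : nonincreasing_kernel G)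
    (G_preserves : preserves_nonnegativity G)
    (K : nat) (K_gt0 : (0 < K)%N) (t : 'I_K -> R) (t_grid : time_grid t)
    (x0 : R) (x : 'I_K -> R) (x0_ge0 : 0 <= x0)
    (nonneg_on_grid : forall k : 'I_K,
      0 <= x0 + \sum_(i < K | (i <= k)%N) x i * G (t k - t i)) :
  forall s : R, 0 <= s ->
    0 <= x0 + \sum_(i < K | t i <= s) x i * G (s - t i).
Proof.
move=> s s_ge0; have [_ G0_gt0] := G_kernel.
have [y [y_ge0 y_eq]] :=
  constant_on_grid_weights G0_gt0 G_nonincreasing t_grid x0_ge0.
have sumD (P : pred 'I_K) u : \sum_(i | P i) (y i + x i) * G (u - t i) =
    \sum_(i | P i) y i * G (u - t i) + \sum_(i | P i) x i * G (u - t i).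
  by rewrite -big_split; apply: eq_bigr => i _; rewrite mulrDl.
have := G_preserves K (fun i => y i + x i) t K_gt0 t_grid _ s s_ge0.
(* On the grid the [y] part equals [x0], which gives the hypothesis on [x]; at time [s] it is at
   most [x0], which gives the conclusion. *)
rewrite sumD => /(_ _)/le_trans; apply.
  by move=> k; rewrite sumD y_eq.
rewrite lerD2r; apply: initial_conv_le => // i j t_js le_ij.
exact: le_trans (time_grid_le t_grid le_ij) t_js.
Qed.
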